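(* Let $(B,+,\circ)$ be a left $RG$-semibrace and let $r_B$ be the solution associated with $B$. Then the following hold: (1) $r_B$ has finite index and period if and only if the group $G/Z(G)$ is periodic, where $G=(B+0,+)$ and $Z(G)$ is its center. (2) If $n:=\exp(G/Z(G))$ is finite, then $r_B^{2n+1}=r_B$. In particular, with $n$ as in (2), $r_B^{2n}=\mathrm{id}_{B\times B}$ if and only if $|E|=1$.
   Context: A right group is a non-empty semigroup $(S,\cdot)$ such that for all $a,b\in S$ there is a unique $x\in S$ with $a\cdot x=b$. A left $RG$-semibrace is a triplet $(B,+,\circ)$ where $+,\circ$ are binary operations on the set $B$ such that $(B,+)$ and $(B,\circ)$ are both right groups and $a\circ(b+c)=a\circ b+(-a+a\circ c)$ for all $a,b,c\in B$, where $-a+a\circ c$ denotes the unique $x\in B$ such that $a+x=a\circ c$. Fix an idempotent $0$ of $(B,\circ)$ (it is then also idempotent in $(B,+)$). Let $E$ be the set of all idempotents of $(B,+)$. The set $G=B+0=\{b+0\mid b\in B\}$ is a subgroup of $(B,+)$ with identity $0$; put $g_b=b+0\in G$, and let $-g_b$ be its inverse in $(G,+)$. The set $H=B\circ 0$ is a subgroup of $(B,\circ)$ with identity $0$; put $h_b=b\circ 0\in H$, and let $h_b^-$ be its inverse in $(H,\circ)$. For $a,b\in B$ put $\lambda_a(b)=-g_a+a\circ b$ (the unique $x\in B$ with $a+x=a\circ b$) and $\rho_b(a)=h^-_{\lambda_a(b)}\circ a\circ b$. The solution associated with $B$ is the map $r_B:B\times B\to B\times B$, $r_B(a,b)=(\lambda_a(b),\rho_b(a))$,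 which is a left non-degenerate set-theoretic solution of the Yang--Baxter equation. Powers of $r_B$ are taken with respect to composition, and $\exp$ denotes the exponent of a group. The index of a solution $r$ is $\mathrm{i}(r)=\min\{j\in\mathbb N_0\mid \exists\, l\in\mathbb N,\ r^j=r^l,\ j\ne l\}$ and its period is $\mathrm{p}(r)=\min\{k\in\mathbb N\mid r^{\mathrm{i}(r)+k}=r^{\mathrm{i}(r)}\}$; here $\mathbb N$ is the set of positive integers and $\mathbb N_0=\mathbb N\cup\{0\}$. Index and period are finite if these minima exist.
   Formalization: In (1), ''G/Z(G) is periodic'' is taken to mean that G/Z(G) has finite exponent; if it only means that every element has finite order, (1) fails, e.g. for the direct sum of dihedral groups of order 2p (p odd prime) with both operations equal. *)

(* Defs.v *)
From mathcomp Require Import all_boot.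
From mathcomp Require Import boolp classical_sets functions cardinality.

Set Implicit Arguments.
Unset Strict Implicit.
Unset Printing Implicit Defensive.

Local Open Scope classical_set_scope.

Definition right_group (S : Type) (op : S -> S -> S) : Prop :=
  [/\ [set: S] !=set0, associative op & forall a b, exists! x, op a x = b].

(* The element x below is the one written [- a + a o c] in the usual
   notation: by [right_group add] it exists and is unique. *)
Definition left_RG_semibrace (B : Type) (add circ : B -> B -> B) : Prop :=
  [/\ right_group add, right_group circ &
      forall a b c x, add a x = circ a c ->
        circ a (add b c) = add (circ a b) x].

Definition idempotents (S : Type) (op : S -> S -> S) : set S :=
  [set e | op e e = e].

(* Groups occur as a carrier [X : set T] with a law [op] and an identity [e],
   since several of them live inside one type, under two different laws. *)
Section Groups.
Variables (T : Type) (op : T -> T -> T).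

(* Total function: the default value [e] is only taken when [x] has no
   inverse in [X]. *)
Definition inverse_in (X : set T) (e x : T) : T :=
  @xget {classic T} e [set y | [/\ X y, op x y = e & op y x = e]].

Definition center_of (X : set T) : set T :=
  [set c | X c /\ forall x, X x -> op c x = op x c].

Definition coset_of (N : set T) (x : T) : set T := [set op x y | y in N].

Definition quotient_by (X N : set T) : set (set T) :=
  [set coset_of N x | x in X].

(* The law of a quotient group: its identity is N. *)
Definition set_op (A C : set T) : set T := [set op a c | a in A & c in C].

Definition power (e x : T) (n : nat) : T := iter n (op x) e.

Definition exponents (X : set T) (e : T) : set nat :=
  [set n | 0 < n /\ forall x, X x -> power e x n = e].

(* A group is called periodic here when a single positive power kills all its
   elements. An exponent depending on the element is not enough for what
   follows: for a group G, viewed as a semibrace whose two laws are equal, the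
   map r(a, b) = (b, - b + a + b) satisfies r^(2d) = id if and only if
   d g is central for every g in G, so on a direct sum of dihedral groups of
   order 2p, p running over the odd primes, its powers are pairwise distinct. *)
Definition periodic (X : set T) (e : T) : Prop := exponents X e !=set0.

End Groups.

Definition is_min (A : set nat) (m : nat) : Prop :=
  A m /\ forall k, A k -> m <= k.

Definition is_exponent (T : Type) (op : T -> T -> T) (X : set T) (e : T) :
  nat -> Prop := is_min (exponents op X e).

Section Solution.
Variables (B : Type) (add circ : B -> B -> B) (z : B).

Definition add_group : set B := [set add b z | b in [set: B]].
Definition circ_group : set B := [set circ b z | b in [set: B]].

Definition lambda (a b : B) : B :=
  add (inverse_in add add_group z (add a z)) (circ a b).

Definition rho (b a : B) : B :=
  circ (circ (inverse_in circ circ_group z (circ (lambda a b) z)) a) b.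

Definition solution (ab : B * B) : B * B :=
  (lambda ab.1 ab.2, rho ab.2 ab.1).

End Solution.

Section IndexPeriod.
Variables (T : Type) (r : T -> T).

Definition is_index : nat -> Prop :=
  is_min [set j | exists l, [/\ 0 < l, iter j r =1 iter l r & j <> l]].

Definition is_period (i : nat) : nat -> Prop :=
  is_min [set k | 0 < k /\ iter (i + k) r =1 iter i r].

Definition finite_index_and_period : Prop :=
  exists i k, is_index i /\ is_period i k.

End IndexPeriod.

(* Main.v *)
Require Import Defs.
From mathcomp Require Import all_boot.
From mathcomp Require Import boolp classical_sets functions cardinality.

(** Write [a \ b] for the solution [x] of [a + x = b] in a right group. The
    map [r = solution add circ z] sends [(a, b)] to the pair [(u, v)] with
    [u = a \ (a o b)] and [u o v = a o b]. Thus it preserves the product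
    [m = a o b], and in the coordinates [(a, m)], which determine [(a, b)]
    because [o] is left cancellative, it becomes [(a, m) |-> (a \ m, m)]
    ([eq_iter_solution]). The second law has disappeared, and everything is
    about the self-map [a |-> a \ m] of the right group [(B, +)], one for
    each [m].

    The square of that map is [a |-> m \ (a + m)], a conjugation by [m] once
    [z] is added on the right. Consequently its [2k]-th power is, in the group
    [G = B + z], the conjugation by [k m] ([iter_ldiv_double]). Two such
    conjugations agree for all [m] exactly when the difference of the exponents sends [G]
    into its center, that is, annihilates [G / Z(G)] ([exponents_quotientP]);
    this gives (1). A single further step [a |-> a \ m] depends on [a] only
    through [a + z], so the conjugation by a central element in front of it
    is invisible: this gives (2). Finally the values of [a |-> a \ m] all have
    the same right unit as [m], so an even power of it can be the identity
    only if all elements have the same right unit, i.e. if [z] is the only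
    idempotent. *)

Local Open Scope classical_set_scope.
Local Open Scope card_scope.

(** * Least elements, index and period *)

Lemma is_min_exists (A : set nat) : A !=set0 -> exists m, is_min A m.
Proof.
case=> n; elim/ltn_ind: n => n IHn An.
have [[k ltkn Ak]|noA] := pselect (exists2 k, k < n & A k).
  exact: IHn ltkn Ak.
exists n; split=> // k Ak; rewrite leqNgt; apply/negP => ltkn.
by apply: noA; exists k.
Qed.

Lemma finite_index_and_periodP (T : Type) (r : T -> T) :
  finite_index_and_period r <->
  exists i k, 0 < k /\ iter (i + k) r =1 iter i r.
Proof.
split=> [[i [k [_ [[k0 rk] _]]]]|[i [k [k0 rk]]]]; first by exists i, k.
set A := [set j | exists l, [/\ 0 < l, iter j r =1 iter l r & j <> l]].
have [|j [[l [l0 rjl jl]] jmin]] := @is_min_exists A.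
  exists i, (i + k); split; first by rewrite addn_gt0 k0 orbT.
  - by move=> x; rewrite rk.
  - by move/eqP; rewrite -{1}[i]addn0 eqn_add2l eq_sym -leqn0 leqNgt k0.
(* a pair (j, l) witnessing j also witnesses l, so the least j is below l *)
have ltjl : j < l.
  rewrite ltn_neqAle; apply/andP; split; first exact/eqP.
  rewrite leqNgt; apply/negP => ltlj.
  have: A l.
    exists j; split; first exact: leq_trans ltlj.
    - by move=> x; rewrite rjl.
    - exact/nesym.
  by move/jmin; rewrite leqNgt ltlj.
have [|p pP] := @is_min_exists [set k | 0 < k /\ iter (j + k) r =1 iter j r].
  by exists (l - j); rewrite /= subn_gt0; split=> // x; rewrite subnKC ?rjl // ltnW.
by exists j, p; split=> //; split=> //; exists l.
Qed.

(** * Division in a right group *)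

Section RightGroup.
Set Implicit Arguments.
Unset Strict Implicit.
Variables (B : Type) (add : B -> B -> B) (z : B).
Hypotheses (hadd : right_group add) (hz : add z z = z).

Local Infix "+" := add.
Local Notation G := (add_group add z).
Local Notation Z := (center_of add G).
Local Notation pow := (power add z).

Lemma rg_addA : associative add.
Proof. by case: hadd. Qed.

Lemma rg_addI a : injective (add a).
Proof.
by case: hadd => _ _ sol x y xy; have [w [_ wu]] := sol a (a + y);
  rewrite -(wu x) ?(wu y).
Qed.

Lemma rg_solve a b : exists x, a + x = b.
Proof. by case: hadd => _ _ /(_ a b) [x []]; exists x. Qed.

Lemma idem_add e x : e + e = e -> e + x = x.
Proof. by move=> ee; apply: (@rg_addI e); rewrite rg_addA ee. Qed.

Lemma add0 x : z + x = x.
Proof. exact: idem_add. Qed.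

Lemma add_z x y : (x + z) + y = x + y.
Proof. by rewrite -rg_addA add0. Qed.

Lemma add_groupP x : G x <-> x + z = x.
Proof.
by split=> [[b _ <-]|xz]; [rewrite -rg_addA hz | exists x].
Qed.

(** Left division, written through the inverse of the [G]-component of [a]: in
    this form it occurs in both components of the solution, under the two
    laws. *)
Definition ldiv a b := inverse_in add G z (a + z) + b.

Lemma ldivP a b : a + ldiv a b = b.
Proof.
have [x ax] := rg_solve a z.
have ayz : (a + z) + (x + z) = z by rewrite add_z rg_addA ax hz.
have yaz : (x + z) + (a + z) = z.
  by apply: (@rg_addI (a + z)); rewrite rg_addA ayz add_z rg_addA add0.
rewrite /ldiv; set i := inverse_in _ _ _ _.
have [_ aiz _] : [/\ G i, (a + z) + i = z & i + (a + z) = z].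
  apply: (@xgetPex {classic B} z
    [set y | [/\ G y, (a + z) + y = z & y + (a + z) = z]]).
  by exists (x + z); split=> //; exists x.
by rewrite rg_addA -(add_z a) aiz add0.
Qed.

Lemma ldivE a b x : a + x = b -> ldiv a b = x.
Proof. by move=> axb; apply: (@rg_addI a); rewrite ldivP. Qed.

Lemma addK a x : ldiv a (a + x) = x.
Proof. exact: ldivE. Qed.

Lemma ldiv_add a b c : ldiv a (b + c) = ldiv a b + c.
Proof. by rewrite /ldiv rg_addA. Qed.

Lemma ldiv_z a x : ldiv (a + z) x = ldiv a x.
Proof. by apply: ldivE; rewrite add_z ldivP. Qed.

Lemma ldivDl a b c : ldiv (a + b) c = ldiv b (ldiv a c).
Proof. by apply: ldivE; rewrite -rg_addA !ldivP. Qed.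

(** Right cancellation holds only up to the part outside [G]. *)
Lemma add_cancelr x y c : x + c = y + c -> x + z = y + z.
Proof. by move=> xy; rewrite -(ldivP c z) !rg_addA xy. Qed.

(** In a group this is [- (- a + m) = - m + a]. *)
Lemma ldiv_ldiv a m : ldiv (ldiv a m) m = ldiv m (a + m).
Proof.
apply: ldivE; apply: (@rg_addI a).
by rewrite rg_addA ldivP ldivP.
Qed.

Lemma pow_z x n : pow x n + z = pow x n.
Proof. by elim: n => //= n IHn; rewrite -rg_addA IHn. Qed.

Lemma powD x n m : pow x (n + m)%N = pow x n + pow x m.
Proof.
by elim: n => [|n IHn]; [rewrite add0n add0 | rewrite /= IHn rg_addA].
Qed.

Lemma pow_add_z x n : pow (x + z) n = pow x n.
Proof. by elim: n => //= n ->; rewrite add_z. Qed.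

(** * Powers of the maps a |-> - a + m *)

(** Even powers of [a |-> ldiv a m] are conjugations in [G]. Adding [z] makes
    this true also for [k = 0], where the component of [a] outside [G] is not
    yet replaced by that of [m]. *)
Lemma iter_ldiv_double m k a :
  iter (2 * k) (ldiv^~ m) a + z = ldiv (pow m k) (a + pow m k).
Proof.
elim: k => [|k IHk]; first by apply/esym/ldivE; rewrite add0.
rewrite mulnS !iterS ldiv_ldiv -ldiv_add -rg_addA -(add_z (iter _ _ _)) IHk.
(* the powers of m commute with m *)
have -> : pow m k.+1 = pow m k + (m + z) by rewrite -addn1 powD.
by rewrite ldivDl ldiv_z -ldiv_add [in RHS]rg_addA.
Qed.

(** * The quotient of G by its center *)

(** The condition [n G <= Z(G)], for arbitrary [a] and [m] instead of elements
    of [G]: as [pow m n] only sees [m + z] and the left addition of [a] only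
    sees [a + z], the commutation in [G] takes this form. *)
Definition central_multiples n :=
  forall a m, a + pow m n = pow m n + (a + z).

Lemma center_z : Z z.
Proof.
split=> [|x /add_groupP xz]; first exact/add_groupP.
by rewrite xz add0.
Qed.

Lemma center_add c d : Z c -> Z d -> Z (c + d).
Proof.
move=> [Gc cC] [/add_groupP dz dC]; split.
  by apply/add_groupP; rewrite -rg_addA dz.
by move=> x Gx; rewrite -rg_addA (dC x Gx) rg_addA (cC x Gx) rg_addA.
Qed.

Lemma center_ldiv c d : Z c -> Z d -> Z (ldiv c d).
Proof.
move=> [_ cC] [/add_groupP dz dC]; split.
  by apply/add_groupP; rewrite -ldiv_add dz.
move=> x Gx; apply: (@rg_addI c).
by rewrite rg_addA ldivP (dC x Gx) rg_addA (cC x Gx) -rg_addA ldivP.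
Qed.

Lemma coset_z : coset_of add Z z = Z.
Proof.
apply/seteqP; split=> [_ [c Zc <-]|c Zc] /=; first by rewrite add0.
by exists c; rewrite ?add0.
Qed.

Lemma set_op_coset x y : G y ->
  set_op add (coset_of add Z x) (coset_of add Z y) = coset_of add Z (x + y).
Proof.
move=> Gy; apply/seteqP; split.
  move=> _ [_ [c Zc <-] [_ [d Zd <-] <-]].
  exists (c + d); first exact: center_add.
  by rewrite !rg_addA -(rg_addA x y c) -(Zc.2 y Gy) !rg_addA.
move=> _ [c Zc <-].
exists (x + z); first by exists z => //; exact: center_z.
by exists (y + c); [exists c | rewrite add_z rg_addA].
Qed.

Lemma power_coset x n :
  power (set_op add) Z (coset_of add Z x) n = coset_of add Z (pow x n).
Proof.
elim: n => [|n IHn]; first by rewrite coset_z.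
rewrite /= /power /= -/(power _ _ _ n) IHn set_op_coset //.
exact/add_groupP/pow_z.
Qed.

Lemma coset_center x : G x -> coset_of add Z x = Z <-> Z x.
Proof.
move=> /add_groupP xz; split=> [<-|Zx]; first by exists z => //; exact: center_z.
apply/seteqP; split=> [_ [c Zc <-]|c Zc]; first exact: center_add.
by exists (ldiv x c); [exact: center_ldiv | rewrite ldivP].
Qed.

(** The [n]-th power of the coset of [x] is the coset of [n x], and this is the
    identity coset exactly when [n x] is central. *)
Lemma exponents_quotientP n :
  exponents (set_op add) (quotient_by add G Z) Z n <->
  0 < n /\ central_multiples n.
Proof.
have Gp m : G (pow m n) by exact/add_groupP/pow_z.
split=> [[n0 nZ]|[n0 nC]]; split=> //.
  move=> a m.
  have : Z (pow m n).
    apply/coset_center => //; rewrite -pow_add_z -power_coset; apply: nZ.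
    by exists (m + z) => //; exists m.
  by move=> [_ /(_ (a + z))] ->; [rewrite add_z | exists a].
move=> _ [x Gx <-]; rewrite power_coset; apply/coset_center => //.
by split=> // a /add_groupP az; rewrite nC az.
Qed.

(** * Equal powers and central multiples *)

(** Equality of two powers leaves, after cancelling the conjugation by [i m],
    the triviality of the conjugation by [k m]. *)
Lemma iter_ldiv_central i k :
  (forall m, iter (2 * (i + k)) (ldiv^~ m) =1 iter (2 * i) (ldiv^~ m)) ->
  central_multiples k.
Proof.
move=> it a m.
have := iter_ldiv_double m (i + k) a.
rewrite it iter_ldiv_double => /(congr1 (add (pow m (i + k)))).
rewrite ldivP addnC powD -rg_addA ldivP !rg_addA => /add_cancelr.
by rewrite -!rg_addA pow_z.
Qed.

Lemma central_iter_double n m a : central_multiples n ->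
  iter (2 * n) (ldiv^~ m) a + z = a + z.
Proof. by move=> nC; rewrite iter_ldiv_double nC addK. Qed.

Lemma central_iter_ldiv n m : central_multiples n ->
  iter (2 * n).+1 (ldiv^~ m) =1 ldiv^~ m.
Proof. by move=> nC a; rewrite iterS -ldiv_z central_iter_double // ldiv_z. Qed.

(** All values of [a |-> ldiv a m] have the right unit of [m]. For [m] an
    idempotent [e], whose right unit is [e], and for the starting point [z],
    this forces [e = z]; conversely, right units are idempotent, so if [z] is
    the only one then [B = G]. *)
Lemma iter_ldiv_id n : 0 < n -> central_multiples n ->
  (forall m, iter (2 * n) (ldiv^~ m) =1 id) <-> idempotents add = [set z].
Proof.
move=> n0 nC; split=> [it|E1 m a].
  apply/seteqP; split=> [e /= ee|_ -> //].
  have : iter (2 * n) (ldiv^~ e) z + e = iter (2 * n) (ldiv^~ e) z.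
    have -> : (2 * n = (2 * n).-1.+1)%N by rewrite prednK // muln_gt0.
    by rewrite iterS -ldiv_add ee.
  by rewrite it /= add0.
have xz x : x + z = x.
  have xe := ldivP x x.
  have : idempotents add (ldiv x x) by rewrite /idempotents /= -ldiv_add xe.
  by rewrite E1 /= => e; rewrite e in xe.
by have := central_iter_double m a nC; rewrite !xz.
Qed.

End RightGroup.

(** * The solution in the coordinates a, a o b *)

Section Semibrace.
Set Implicit Arguments.
Unset Strict Implicit.
Variables (B : Type) (add circ : B -> B -> B) (z : B).
Hypotheses (hB : left_RG_semibrace add circ) (hz : circ z z = z).

Lemma semibrace_add : right_group add. Proof. by case: hB. Qed.
Lemma semibrace_circ : right_group circ. Proof. by case: hB. Qed.

(** As [z] is a left unit for the second law, the semibrace identity at [z]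
    reads [b + c = b + (- z + c)]. *)
Lemma add_idem : add z z = z.
Proof.
have zl x : circ z x = x by exact: (idem_add semibrace_circ).
have [x zx] := rg_solve semibrace_add z z.
case: hB => _ _ /(_ z z z x).
rewrite !zl zx => /(_ erefl) e.
by rewrite e.
Qed.

Local Notation r := (solution add circ z).
Local Notation ldiv := (ldiv add z).

(** The division in the second law hidden in [rho] makes the solution preserve
    the product of the two components. *)
Lemma circ_rho a b : circ (ldiv a (circ a b)) (rho add circ z b a) = circ a b.
Proof.
have cA := rg_addA semibrace_circ.
rewrite -[RHS](ldivP semibrace_circ hz (ldiv a (circ a b)) (circ a b)).
by rewrite /rho -cA.
Qed.

Lemma iter_solution k a b :
  (iter k r (a, b)).1 = iter k (ldiv^~ (circ a b)) a /\
  circ (iter k r (a, b)).1 (iter k r (a, b)).2 = circ a b.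
Proof.
elim: k => [|k [IH1 IH2]] //=.
move: (iter k r (a, b)) IH1 IH2 => [u v] /= <- uv.
by rewrite /lambda -{1}uv circ_rho.
Qed.

(** The product [m = circ a b] can be prescribed independently of [a], and it
    recovers the second component from the first. *)
Lemma eq_iter_solution i j :
  iter i r =1 iter j r <->
  forall m, iter i (ldiv^~ m) =1 iter j (ldiv^~ m).
Proof.
split=> [e m a|e [a b]].
  have [b abm] := rg_solve semibrace_circ a m.
  have [ei _] := iter_solution i a b.
  have [ej _] := iter_solution j a b.
  by rewrite -abm -ei -ej e.
have [ei ci] := iter_solution i a b.
have [ej cj] := iter_solution j a b.
rewrite [LHS]surjective_pairing [RHS]surjective_pairing.
have e1 : (iter i r (a, b)).1 = (iter j r (a, b)).1 by rewrite ei ej e.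
congr (_, _) => //; apply: (rg_addI semibrace_circ (a := (iter i r (a, b)).1)).
by rewrite ci e1 cj.
Qed.

End Semibrace.

(** * Index, period and exponent *)

Theorem proposition3p8 (B : Type) (add circ : B -> B -> B) (z : B)
    (hB : left_RG_semibrace add circ) (hz : circ z z = z) :
  let r := solution add circ z in
  let G := add_group add z in
  let Z := center_of add G in
  let GmodZ := quotient_by add G Z in
  [/\ finite_index_and_period r <-> periodic (set_op add) GmodZ Z,
      forall n, is_exponent (set_op add) GmodZ Z n ->
        iter (2 * n + 1) r =1 r &
      forall n, is_exponent (set_op add) GmodZ Z n ->
        (iter (2 * n) r =1 id <-> idempotents add #= `I_1)].
Proof.
move=> r G Z GmodZ.
have hadd := semibrace_add hB.
have zz := add_idem hB hz.
have expP := exponents_quotientP hadd zz.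
have iterP := eq_iter_solution hB hz.
have odd_r n : central_multiples add z n -> iter (2 * n + 1) r =1 r.
  move=> nC; rewrite addn1; apply/(iterP _ 1) => m.
  exact: central_iter_ldiv.
split.
- apply: iff_trans (finite_index_and_periodP _ r) _; split.
    (* r^(i + k) = r^i gives r^(2 (i + k)) = r^(2 i): even powers suffice *)
    move=> [i [k [k0 rk]]]; exists k; apply/expP; split=> //.
    apply: (iter_ldiv_central hadd zz (i := i)); apply/iterP => x.
    have rkk y : iter (i + (k + k)) r y = iter i r y.
      by rewrite addnA addnC iterD rk -iterD addnC rk.
    have -> : (2 * (i + k) = i + (k + k) + i)%N.
      by rewrite mul2n -addnn addnACA addnAC.
    by rewrite iterD rkk -iterD mul2n addnn.
  move=> [n /expP [n0 nC]]; exists 1, (2 * n)%N.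
  by rewrite muln_gt0 n0 addnC; split=> //; exact: odd_r.
- by move=> n [/expP [_ nC] _]; exact: odd_r.
move=> n [/expP [n0 nC] _].
apply: iff_trans (iterP (2 * n)%N 0) _.
apply: iff_trans (iter_ldiv_id hadd zz n0 nC) _.
split=> [->|]; first exact: card_set1.
rewrite II1 => /card_set_bijP [f [f0 finj _]].
apply/seteqP; split=> [e Ee|_ -> //].
by apply: finj; rewrite ?inE // (f0 _ Ee) (f0 z).
Qed.
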